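(* Let $K$ be a totally real number field with ring of integers $\mathcal{O}_K$. If every element of $2\mathcal{O}_K^+$ is a sum of squares of elements of $\mathcal{O}_K$, then $K$ is generated, as a field extension of $\mathbb{Q}$, by the elements $\alpha\in\mathcal{O}_K$ whose house is less than $1+\sqrt{11}$.
   Context: The house of $\alpha\in K$ is $\max_i|\sigma_i(\alpha)|$, where $\sigma_1,\dots,\sigma_d:K\hookrightarrow\mathbb{R}$ are the embeddings of $K$. $\mathcal{O}_K^+$ is the set of totally positive elements of $\mathcal{O}_K$ (those with $\sigma_i(\alpha)>0$ for all $i$), and $2\mathcal{O}_K^+=\{2\alpha:\alpha\in\mathcal{O}_K^+\}$. A sum of squares means a sum of finitely many (arbitrarily many) squares. *)

(* Defs.v *)
From HB Require Import structures.
From mathcomp Require Import all_boot all_order all_algebra all_field.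
From mathcomp Require Import complex.
From mathcomp Require Import boolp classical_sets reals.

Set Implicit Arguments.
Unset Strict Implicit.
Unset Printing Implicit Defensive.

Import Order.TTheory GRing.Theory Num.Theory.

Local Open Scope classical_set_scope.
Local Open Scope ring_scope.

Definition totally_real (R : realType) (K : fieldExtType rat) : Prop :=
  forall (f : {rmorphism K -> R[i]%type}) (x : K), exists y : R, f x = (y%:C)%C.

Definition ring_of_integers (K : fieldExtType rat) : set K :=
  [set x | integralOver (intr : int -> K) x].
Arguments ring_of_integers K : clear implicits.

Definition totally_positive_integers (R : realType) (K : fieldExtType rat) :
    set K :=
  [set x | ring_of_integers K x /\
           forall sigma : {rmorphism K -> R}, 0 < sigma x].
Arguments totally_positive_integers R K : clear implicits.

Definition sums_of_squares_of_integers (K : fieldExtType rat) : set K :=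
  [set x | exists2 s : seq K,
     (forall y, y \in s -> ring_of_integers K y) & x = \sum_(y <- s) y ^+ 2].
Arguments sums_of_squares_of_integers K : clear implicits.

(* K has finitely many embeddings into R, and at least one when it is totally
   real, so that this supremum is then a maximum. *)
Definition house (R : realType) (K : fieldExtType rat) (x : K) : R :=
  sup [set `|sigma x| | sigma in [set: {rmorphism K -> R}]].

(* A subfield of K contains rat, so {subfield K} ranges over all subfields. *)
Definition generates_field (K : fieldExtType rat) (S : set K) : Prop :=
  forall E : {subfield K}, (forall x, S x -> x \in E) -> forall x : K, x \in E.

(* Main.v *)
(** Let [E] be a subfield containing all integers of house below [1 + sqrt 11],
    and suppose [E] is proper. By Northcott finiteness there is an integer [a]
    outside [E] of minimal house [h]. With [n = floor h + 1], write [2 (n + a)]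
    as a sum of squares; some summand [b ^ 2] has [b] outside [E], so
    [h ^ 2 <= 2 (n + h) <= 4 h + 2], which forces [h < 5], hence [n <= 5] and
    [h ^ 2 <= 10 + 2 h], i.e. [h <= 1 + sqrt 11]. In the remaining case
    [h = 1 + sqrt 11], one of [a - 1], [a + 1] squares to [11], so it has house
    [sqrt 11 < h] and lies outside [E], against minimality. *)

From HB Require Import structures.
Require Import Defs.
From mathcomp Require Import all_boot all_order all_algebra all_field.
From mathcomp Require Import boolp classical_sets reals complex cardinality.
From mathcomp Require Import zify lra ring.

Set Implicit Arguments.
Unset Strict Implicit.
Unset Printing Implicit Defensive.

Import Order.TTheory GRing.Theory Num.Theory.

Local Open Scope classical_set_scope.
Local Open Scope ring_scope.

(** * Extending field embeddings *)

(** Every element of [L] is a polynomial in [t], and polynomials vanishing at [t] are multiples of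
    [p], hence vanish at [z]. So sending [q(t)] to [q(z)] is well defined. *)
Lemma rmorphism_extension (F L C : fieldType) (i : {rmorphism F -> L})
    (f : {rmorphism F -> C}) (t : L) (p : {poly F}) (z : C) :
  (forall y, exists q, (map_poly i q).[t] = y) ->
  (forall q, root (map_poly i q) t -> p %| q) ->
  root (map_poly f p) z ->
  exists2 g : {rmorphism L -> C}, g t = z & forall a, g (i a) = f a.
Proof.
move=> /choice[Q QK] pP pz.
pose g y := (map_poly f (Q y)).[z].
have gE y q : (map_poly i q).[t] = y -> g y = (map_poly f q).[z].
  move=> qt; apply/eqP; rewrite -subr_eq0 -hornerN -hornerD -rmorphB.
  have /dvdpP[r ->] : p %| Q y - q.
    by apply: pP; rewrite /root rmorphB hornerD hornerN QK qt subrr.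
  by rewrite rmorphM hornerM (rootP pz) mulr0.
have gB : zmod_morphism g.
  move=> x y; rewrite (gE _ (Q x - Q y)) ?rmorphB ?hornerD ?hornerN //.
  by rewrite !QK.
have gM : monoid_morphism g.
  split=> [|x y]; first by rewrite (gE _ 1) rmorph1 hornerC.
  by rewrite (gE _ (Q x * Q y)) rmorphM hornerM // !QK.
pose G : {rmorphism L -> C} := HB.pack g
  (GRing.isZmodMorphism.Build L C g gB) (GRing.isMonoidMorphism.Build L C g gM).
exists G => [|a] /=.
  by rewrite (gE _ 'X) map_polyX hornerX.
by rewrite (gE _ a%:P) map_polyC hornerC.
Qed.

(* The embedding is built first on [Q(x)], sending [x] to [z], then extended to
   [K] by a primitive element over [Q(x)]. *)
Lemma embedding_with_value (K : fieldExtType rat) (C : numClosedFieldType)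
    (x : K) (p : {poly rat}) (z : C) :
  minPoly 1 x = map_poly (in_alg K) p -> root (map_poly ratr p) z ->
  exists f : {rmorphism K -> C}, f x = z.
Proof.
move=> pE pz; set E := <<1; x>>%AS.
have xE : x \in E := memv_adjoin _ _.
have valE (q : {poly rat}) : map_poly (in_alg K) q =
  map_poly vsval (map_poly (in_alg (subvs_of E)) q).
  by rewrite -map_poly_comp; apply: eq_map_poly => a /=; rewrite algid1.
have [||f fx _] := @rmorphism_extension rat (subvs_of E) C (in_alg _) ratr
  (vsproj E x) p z _ _ pz.
- move=> y; have /polyOver1P[q qE] := Fadjoin_polyOver 1%AS x (vsval y).
  exists q; apply: val_inj => /=; rewrite -horner_map /= -valE vsprojK //.
  by rewrite -qE Fadjoin_poly_eq // subvsP.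
- move=> q qx; rewrite -(dvdp_map (in_alg K)) -pE minPoly_dvdp //.
    by apply/polyOver1P; exists q.
  move: qx; rewrite /root -(inj_eq val_inj) /=.
  by rewrite -horner_map /= -valE vsprojK.
set t := separable_generator E {:K}.
have tK : <<E; t>>%VS = {:K}%VS.
  rewrite -eq_adjoin_separable_generator ?subvf //.
  apply/separableP=> y _; apply: pcharf0_separable => r.
  by rewrite (fmorph_pchar (in_alg K)) pchar_num.
have /polyOver_subvs[m mE] := minPolyOver E t.
have [w mw] : exists w, root (map_poly f m) w.
  apply/closed_rootP; rewrite size_map_poly -(size_map_poly vsval) -mE.
  by rewrite size_minPoly.
have [||g _ gf] := @rmorphism_extension _ K C vsval f t m w _ _ mw.
- move=> y; have /polyOver_subvs[q qE] := Fadjoin_polyOver E t y.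
  by exists q; rewrite -qE Fadjoin_poly_eq // tK memvf.
- move=> q qt; rewrite -(dvdp_map vsval) -mE minPoly_dvdp //.
  by apply/polyOver_subvs; exists q.
by exists g; rewrite -fx -gf /= vsprojK.
Qed.

Lemma exists_embedding (K : fieldExtType rat) (C : numClosedFieldType) :
  exists f : {rmorphism K -> C}, True.
Proof.
(* The minimal polynomial of [0] is [X], so prescribing the value [0] at [0] is no constraint. *)
have [||f _] := @embedding_with_value K C 0 'X 0 _ _.
- by rewrite map_polyX (minPoly_XsubC (mem0v _)) subr0.
- by rewrite map_polyX rootX.
by exists f.
Qed.

(** * Integrality and minimal polynomials *)

Lemma map_in_alg_intr (K : fieldExtType rat) (q : {poly int}) :
  map_poly (in_alg K) (map_poly intr q) = map_poly intr q.
Proof.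
by rewrite -map_poly_comp; apply: eq_map_poly => a /=; rewrite scaler_int.
Qed.

Lemma intr_fieldExt_inj (K : fieldExtType rat) : injective (intr : int -> K).
Proof.
by move=> a b; rewrite -!scaler_int => /(fmorph_inj (in_alg K))/intr_inj.
Qed.

(** Gauss's lemma: the minimal polynomial divides a monic integer polynomial, so it is a rational
    multiple of an integer factor, whose leading coefficient is a unit. *)
Lemma integral_minPoly_int (K : fieldExtType rat) (x : K) :
  ring_of_integers K x -> exists p : {poly int}, minPoly 1 x = map_poly intr p.
Proof.
move=> [r r_mon rx]; have /polyOver1P[p mE] := minPolyOver 1%AS x.
have p_mon : p \is monic by rewrite -(map_monic (in_alg K)) -mE monic_minPoly.
have /dvdpP_rat_int[p1 [a a0 pE] [s rE]] : p %| map_poly intr r.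
  rewrite -(dvdp_map (in_alg K)) -mE map_in_alg_intr minPoly_dvdp //.
  by apply/polyOver1P; exists (map_poly intr r); rewrite map_in_alg_intr.
set u := lead_coef p1.
have u1 : u * u = 1.
  have : u * lead_coef s = 1 by rewrite -lead_coefM -rE (monicP r_mon).
  move/(congr1 absz)/eqP; rewrite abszM muln_eq1 => /andP[/eqP u1 _].
  by rewrite -expr2 -real_normK ?num_real // -abszE u1.
have au : a * u%:~R = 1.
  have := monicP p_mon; rewrite pE lead_coefZ lead_coef_map_inj //.
  exact: intr_inj.
(* As [u] is its own inverse, the scalar [a] equals [u]. *)
exists (u *: p1); rewrite -map_in_alg_intr mE; congr map_poly.
rewrite pE map_polyZ; congr (_ *: _).
by rewrite -[RHS]mul1r -au -mulrA -intrM u1 mulr1.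
Qed.

(** An integer polynomial vanishing at [x], with leading coefficient [c], turns into a monic one in
    [c x] after scaling by a power of [c]. *)
Lemma exists_integral_multiple (K : fieldExtType rat) (x : K) :
  exists2 c : int, c != 0 & ring_of_integers K (c%:~R * x).
Proof.
have /polyOver1P[p mE] := minPolyOver 1%AS x.
have [q [a a0 pE]] := rat_poly_scale p.
have qx : root (map_poly intr q) x.
  have := root_minPoly 1%AS x; rewrite mE pE map_polyZ rootZ; last first.
    by rewrite fmorph_eq0 invr_eq0 intr_eq0.
  by rewrite map_in_alg_intr.
have p0 : p != 0.
  by rewrite -(map_poly_eq0 (in_alg K)) -mE monic_neq0 // monic_minPoly.
have q0 : q != 0.
  by apply: contra_neq p0 => q0; rewrite pE q0 map_poly0 scaler0.
set c := lead_coef q; have c0 : c != 0 by rewrite lead_coef_eq0.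
have intK := @intr_fieldExt_inj K.
exists c => //; have [n sq] : exists n, size q = n.+2.
  have : (1 < size q)%N.
    have := root_size_gt1 _ qx.
    by rewrite -size_poly_eq0 size_map_inj_poly // size_poly_eq0; apply.
  by case: (size q) => [|[|n]] // _; exists n.
(* [r.[c x] = c ^ n * q.[x]], where [n + 1] is the degree of [q]. *)
pose r := \poly_(i < n.+2) if i == n.+1 then 1 else q`_i * c ^+ (n - i).
have r_lead : r`_n.+1 = 1 by rewrite coef_poly ltnSn eqxx.
have r_size : size r = n.+2 by rewrite size_poly_eq // eqxx oner_neq0.
exists r; first by rewrite monicE /lead_coef r_size r_lead.
have: c%:~R ^+ n * (map_poly intr q : {poly K}).[x] = 0.
  by rewrite (rootP qx) mulr0.
rewrite /root !(@horner_coef_wide _ n.+2) ?size_map_inj_poly ?sq ?r_size //.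
rewrite mulr_sumr => /eqP; congr (_ == 0); apply: eq_bigr => i _.
rewrite !coef_map coef_poly ltn_ord /= exprMn_comm; last exact: mulrC.
(* The top term is apart: at [i = n + 1] the truncated [n - i] is [0], where the exponent should be
   [-1]. *)
have [-> | i_n] := eqVneq.
  rewrite -[n.+1]/(n.+2.-1) -sq -lead_coefE -/c sq /= mul1r.
  by rewrite mulrA -exprSr.
have le_in : (i <= n)%N by case: i i_n => i /= lt_i i_n; lia.
by rewrite rmorphM rmorphXn -{1}(subnK le_in) exprD; ring.
Qed.

(** * Finiteness of integers with bounded conjugates *)

Lemma finite_set_root (F : fieldType) (p : {poly F}) :
  p != 0 -> finite_set [set x | root p x].
Proof.
move=> p0; apply: contrapT => /infinite_set_fset-/(_ (size p))[B Bp].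
apply/negP; rewrite -ltnNge max_poly_roots //; last exact: finmap.fset_uniq.
by apply/allP => x /Bp.
Qed.

Lemma finite_set_argmin (T : choiceType) (d : Order.disp_t) (R : orderType d)
    (A : set T) (f : T -> R) :
  finite_set A -> A !=set0 -> exists2 a, A a & forall b, A b -> (f a <= f b)%O.
Proof.
move=> /finite_seqP[s ->] [a]; elim: s a => [|x s IH] a //= _.
case: s IH => [|y s] IH.
  by exists x => [|b]; rewrite /= ?mem_head // inE => /eqP->.
have [b bs bP] := IH y (mem_head _ _).
have [xb|/ltW bx] := leP (f x) (f b).
  exists x => [|e] /=; first exact: mem_head.
  by rewrite inE => /orP[/eqP->//|/bP]; apply: le_trans.
exists b => [|e] /=; first by rewrite inE bs orbT.
by rewrite inE => /orP[/eqP->//|/bP].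
Qed.

(** Multiplying by [X - z] combines a shifted coefficient with [z] times another, so each root costs
    at most a factor [1 + B]. *)
Lemma coef_prod_XsubC_le (F : numFieldType) (r : seq F) (B : F) (i : nat) :
  0 <= B -> (forall z, z \in r -> `|z| <= B) ->
  `|(\prod_(z <- r) ('X - z%:P))`_i| <= (1 + B) ^+ size r.
Proof.
move=> B0; elim: r i => [|z r IH] i rB.
  by rewrite big_nil coef1 normr_nat lern1 leq_b1.
have {}IH j : `|(\prod_(z <- r) ('X - z%:P))`_j| <= (1 + B) ^+ size r.
  by apply: IH => w wr; apply: rB; rewrite inE wr orbT.
rewrite big_cons mulrBl coefB coefXM coefCM /= exprS mulrDl mul1r.
apply: le_trans (ler_normB _ _) _; apply: lerD.
  by case: eqP => // _; rewrite normr0 exprn_ge0 ?addr_ge0.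
by rewrite normrM ler_pM // rB ?mem_head.
Qed.

(* Northcott: the minimal polynomial is integral, with roots bounded by [B]. *)
Lemma finite_bounded_integers (K : fieldExtType rat) (C : numClosedFieldType)
    (B : nat) :
  finite_set [set x | ring_of_integers K x /\
                      forall f : {rmorphism K -> C}, `|f x| <= B%:R].
Proof.
(* The degree is at most [n] and the coefficients lie in [[-M, M]]. [P] encodes them as ordinals
   shifted by [M], so its range is finite. *)
set n := \dim {:K}; set M := (B.+1 ^ n)%N.
pose P (c : {ffun 'I_n.+1 -> 'I_(M + M).+1}) : {poly int} :=
  \poly_(i < n.+1) ((c (inord i))%:Z - M%:Z).
pose D := [set p : {poly int} | range P p /\ p \is monic].
apply: (@sub_finite_set _ _
  (\bigcup_(p in D) [set x : K | root (map_poly intr p) x])); last first.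
  apply: bigcup_finite => [|p [_ /monic_neq0 p0]].
    by apply: (@sub_finite_set _ _ (range P)) => [p []//|]; apply: finite_image.
  apply: finite_set_root.
  rewrite -size_poly_eq0 size_map_inj_poly ?size_poly_eq0 //.
  exact: intr_fieldExt_inj.
move=> x [/integral_minPoly_int[p pE] xB].
have p_mon : p \is monic.
  have := monic_minPoly 1 x; rewrite pE -map_in_alg_intr map_monic !monicE.
  rewrite (lead_coef_map_inj (@intr_inj rat)) //.
  by rewrite (inj_eq (@intr_inj rat) _ 1).
exists p; last by rewrite /= -pE root_minPoly.
split=> //.
have p_size : (size p <= n.+1)%N.
  have -> : size p = size (minPoly 1 x).
    by rewrite pE size_map_inj_poly //; exact: intr_fieldExt_inj.
  rewrite size_minPoly ltnS adjoin_degreeE dimv1 divn1.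
  exact/dimvS/subvf.
have p_bound i : (absz (p`_i)%R <= M)%N.
  have [r rE] := closed_field_poly_normal (map_poly intr p : {poly C}).
  have ratr_p : map_poly ratr (map_poly intr p) = map_poly intr p :> {poly C}.
    by rewrite -map_poly_comp; apply: eq_map_poly => a /=; rewrite ratr_int.
  have p_lead : lead_coef (map_poly intr p : {poly C}) = 1.
    by rewrite lead_coef_map_inj ?(monicP p_mon) //; exact: intr_inj.
  rewrite p_lead scale1r in rE.
  have rB z : z \in r -> `|z| <= B%:R.
    (* Each root of the minimal polynomial is the image of [x] under some embedding. *)
    move=> zr; have [||f <-] := @embedding_with_value K C x (map_poly intr p) z.
    - by rewrite map_in_alg_intr.
    - by rewrite ratr_p rE root_prod_XsubC.
    exact: xB.
  have r_size : (size r <= n)%N.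
    rewrite -ltnS (leq_trans _ p_size) //.
    rewrite -(size_map_inj_poly (@intr_inj C) (mulr0z 1) p) rE.
    by rewrite size_prod_XsubC.
  rewrite -(ler_nat C) natr_absz intr_norm.
  have := @coef_prod_XsubC_le C r B%:R i (ler0n _ _) rB.
  rewrite -rE coef_map /= => /le_trans; apply.
  by rewrite nat1r -natrX ler_nat leq_pexp2l.
exists [ffun i : 'I_n.+1 => inord (absz (p`_i + M%:Z))] => //.
apply/polyP => i; rewrite coef_poly.
case: ltnP => [i_lt | ip]; last by rewrite nth_default // (leq_trans p_size).
rewrite ffunE inordK // inordK //; have := p_bound i; lia.
Qed.

(** * Real embeddings and the house *)

(** Links complex embeddings, which exist by algebraic closedness, to the real ones that define the
    house. *)
Lemma real_embedding_of_complex (R : realType) (K : fieldExtType rat)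
    (f : {rmorphism K -> R[i]%type}) :
  totally_real R K -> exists g : {rmorphism K -> R}, forall x, f x = (g x)%:C%C.
Proof.
move=> totK; have [g fg] := choice (totK f).
have gB : zmod_morphism g.
  by move=> x y; apply: complexI; rewrite -fg !rmorphB /= -!fg.
have gM : monoid_morphism g.
  by split=> [|x y]; apply: complexI; rewrite -fg ?rmorph1 // !rmorphM /= -!fg.
pose G : {rmorphism K -> R} := HB.pack g
  (GRing.isZmodMorphism.Build K R g gB) (GRing.isMonoidMorphism.Build K R g gM).
by exists G.
Qed.

Lemma house_attained (R : realType) (K : fieldExtType rat) (x : K) :
  totally_real R K ->
  (exists s : {rmorphism K -> R}, `|s x| = house R x) /\
  forall s : {rmorphism K -> R}, `|s x| <= house R x.
Proof.
move=> totK; pose A := [set `|s x| | s in [set: {rmorphism K -> R}]].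
have /polyOver1P[p pE] := minPolyOver 1%AS x.
(* Every [s x] is a root of the minimal polynomial of [x]. *)
have finA : finite_set A.
  have p0 : map_poly ratr p != 0 :> {poly R}.
    rewrite map_poly_eq0 -(map_poly_eq0 (in_alg K)) -pE monic_neq0 //.
    exact: monic_minPoly.
  apply: sub_finite_set (finite_image Num.norm (finite_set_root p0)).
  move=> _ [s _ <-]; exists (s x) => //=.
  have := root_minPoly 1%AS x; rewrite pE -(fmorph_root s) -map_poly_comp.
  congr (root _ _); apply: eq_map_poly => a /=.
  by rewrite -(fmorph_eq_rat (s \o in_alg K)).
have A0 : A !=set0.
  have [f _] := exists_embedding K R[i]%type.
  by have [s _] := real_embedding_of_complex f totK; exists `|s x|, s.
(* Minimizing the opposite yields the maximum. *)
have [_ [s _ <-] sP] := finite_set_argmin -%R finA A0.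
have sU y : A y -> y <= `|s x| by move/sP; rewrite lerN2.
have -> : house R x = `|s x|.
  apply/le_anti/andP; split; first exact: ge_sup.
  by apply: ub_le_sup; [exists `|s x| | exists s].
by split=> [|u]; [exists s | apply: sU; exists u].
Qed.

Lemma finite_integers_house_le (R : realType) (K : fieldExtType rat) (B : R) :
  totally_real R K ->
  finite_set [set x | ring_of_integers K x /\ house R x <= B].
Proof.
move=> totK.
apply: sub_finite_set (finite_bounded_integers K R[i]%type (Num.truncn B).+1).
move=> x [xO xB]; split=> // f.
have [g ->] := real_embedding_of_complex f totK.
rewrite normc_def /= expr0n addr0 sqrtr_sqr -(rmorph_nat (real_complex R)) lecR.
have [_ gx] := house_attained x totK.
by apply: le_trans (gx g) (le_trans xB (ltW (truncnS_gt B))).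
Qed.

(** * Integers of minimal house outside a subfield *)

Lemma exists_integer_notin (K : fieldExtType rat) (E : {subfield K}) (x : K) :
  x \notin E -> exists2 a, ring_of_integers K a & a \notin E.
Proof.
move=> xE; have [c c0 cx] := exists_integral_multiple x.
exists (c%:~R * x) => //; apply: contra xE => cxE.
have c0' : c%:~R != 0 :> K.
  by rewrite -(mulr0z 1) (inj_eq (@intr_fieldExt_inj K)).
by rewrite -(mulKf c0' x) rpredM // rpredV rpred_int.
Qed.

Theorem theorem3p2 (R : realType) (K : fieldExtType rat) :
  totally_real R K ->
  [set 2 * a | a in totally_positive_integers R K]
    `<=` sums_of_squares_of_integers K ->
  generates_field
    [set a : K | ring_of_integers K a /\ house R a < 1 + Num.sqrt 11].
Proof.
move=> totK sosK E smallE x; apply: contrapT => /negP xE.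
have [a0 a0O a0E] := exists_integer_notin xE.
(* The cut at the house of [a0] makes [S] finite; beyond it, minimality is automatic. *)
pose S := [set a : K | [/\ ring_of_integers K a, a \notin E &
                          house R a <= house R a0]].
have finS : finite_set S.
  by apply: sub_finite_set (finite_integers_house_le (house R a0) totK) => a [].
have [|a [aO aE aa0] aP] := finite_set_argmin (@house R K) finS.
  by exists a0.
set h := house R a in aa0 aP.
have minh b : ring_of_integers K b -> b \notin E -> h <= house R b.
  move=> bO bE; have [ba0|/ltW a0b] := leP (house R b) (house R a0).
    by apply: aP.
  exact: le_trans a0b.
have natO k : ring_of_integers K k%:R by exact: integral_nat.
have h_ge : 1 + Num.sqrt 11 <= h.
  by rewrite leNgt; apply: contra aE => ?; apply: smallE.
set w := Num.sqrt 11 in h_ge.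
have w2 : w ^+ 2 = 11 by rewrite sqr_sqrtr.
have w0 : 0 <= w := sqrtr_ge0 _.
have [[s sa] leh] := house_attained a totK; rewrite -/h in sa leh.
have h0 : 0 <= h by rewrite -sa.
set n := (Num.truncn h).+1.
have hn : h < n%:R := truncnS_gt h.
have nh : n%:R <= h + 1 by rewrite -natr1 lerD2r truncn_le.
have [l lO sumE] : sums_of_squares_of_integers K (2 * (n%:R + a)).
  apply: sosK; exists (n%:R + a) => //; split.
    by apply: integral_add => //; apply: natO.
  move=> u; rewrite rmorphD rmorph_nat.
  by have := leh u; rewrite ler_norml => /andP[? _]; lra.
(* Otherwise the sum, and with it [a], would lie in [E]. *)
have [b bl bE] : exists2 b, b \in l & b \notin E.
  apply: contrapT => lE; move/negP: aE; apply.
  have -> : a = 2^-1 * (2 * (n%:R + a)) - n%:R.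
    rewrite mulKf; first by rewrite [n%:R + a]addrC addrK.
    by rewrite -(fmorph_eq0 s) rmorph_nat pnatr_eq0.
  rewrite rpredB ?rpred_nat // rpredM // ?rpredV ?rpred_nat // sumE.
  rewrite big_seq rpred_sum // => b bl; rewrite rpredX //.
  by apply: contrapT => /negP bE; apply: lE; exists b.
(* At [u], where [b] attains its house, the other squares are nonnegative, so [u b ^+ 2] is at most
   the whole sum. *)
have [[u ub] _] := house_attained b totK.
have hb : h <= `|u b| by rewrite ub; apply: minh => //; apply: lO.
have h2 : h ^+ 2 <= 2 * (n%:R + h).
  apply: (@le_trans _ _ (u (2 * (n%:R + a)))); last first.
    rewrite rmorphM rmorph_nat [u (_ + _)]rmorphD rmorph_nat.
    by have := leh u; rewrite ler_norml => /andP[_ ?]; lra.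
  apply: (@le_trans _ _ (u b ^+ 2)).
    by rewrite -[u b ^+ 2]real_normK ?num_real // lerXn2r ?nnegrE.
  rewrite sumE (big_rem b) //= rmorphD rmorphXn lerDl rmorph_sum sumr_ge0 //.
  by move=> y _; rewrite rmorphXn sqr_ge0.
(* If [h >= 5], then [5 h <= h ^ 2 <= 4 h + 2] gives [h <= 2]. *)
have h5 : h < 5.
  rewrite ltNge; apply/negP => h5; have := ler_wpM2r h0 h5.
  by rewrite -expr2; lra.
have n5 : n%:R <= 5 :> R.
  by rewrite ler_nat -(ltr_nat R) (le_lt_trans _ h5) // truncn_le.
(* Completing the square in [h ^ 2 <= 10 + 2 h] gives [(h - 1) ^ 2 <= 11]. *)
have hE : h = 1 + w.
  apply/le_anti; rewrite h_ge andbT addrC -lerBlDr.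
  rewrite -ler_sqr ?nnegrE ?w2 //; first by rewrite sqrrB1; lra.
  by rewrite subr_ge0 (le_trans _ h_ge) // lerDl.
(* [c] has the sign of [s a], so subtracting it brings the absolute value down from [1 + w] to
   [w]. *)
pose c : K := if s a == h then 1 else -1.
have sc : (s (a - c)) ^+ 2 = 11.
  rewrite rmorphB /c; move/eqP: sa; rewrite eqr_norml h0 andbT => /orP[]/eqP sa.
    by rewrite sa eqxx rmorph1 hE -w2; ring.
  rewrite sa; case: eqP => [|_]; first by lra.
  by rewrite rmorphN rmorph1 hE -w2; ring.
have cO : ring_of_integers K c.
  by rewrite /c; case: ifP => _; [|apply: integral_opp]; apply: integral1.
have cE : c \in E by rewrite /c; case: ifP; rewrite ?rpredN rpred1.
have /minh : ring_of_integers K (a - c) by exact: integral_sub.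
rewrite rpredBr // => /(_ aE).
have [[v <-] _] := house_attained (a - c) totK.
(* By injectivity of [s] the equation holds in [K], so every embedding, not only [s], gives absolute
   value [w]. *)
have {}sc : (a - c) ^+ 2 = 11.
  by apply: (fmorph_inj s); rewrite rmorphXn sc rmorph_nat.
have : `|v (a - c)| ^+ 2 = 11.
  by rewrite real_normK ?num_real // -rmorphXn sc rmorph_nat.
rewrite -w2 => /eqP; rewrite eqrXn2 // => /eqP ->.
by rewrite hE; lra.
Qed.
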